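(* Let $N\ge 3$, let $\Omega$ be an exterior domain in $\mathbb{R}^N$, and let $E$ be a positive smooth function in $\Omega$ with $-\Delta E\ge 0$ in $\Omega$. Then $$\liminf_{|x|\to\infty}|x|^2\,\frac{-\Delta E(x)}{E(x)}\ \le\ \frac{(N-2)^2}{4}.$$
   Context: An exterior domain is a connected open subset of $\mathbb{R}^N$ with compact complement; in particular it contains $\{|x|>R_0\}$ for some $R_0>0$. *)

(* Defs.v *)
From HB Require Import structures.
From mathcomp Require Export all_boot all_order all_algebra.
From mathcomp Require Export all_classical all_reals all_analysis.
Export numFieldNormedType.Exports.

Set Implicit Arguments.
Unset Strict Implicit.
Unset Printing Implicit Defensive.

Import Order.TTheory GRing.Theory Num.Theory.
Local Open Scope classical_set_scope.
Local Open Scope ring_scope.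

(* The library norm on 'rV[R]_N is the sup norm; the topology it induces is
   the usual one, but lengths have to be measured with the norm below. *)
Definition enorm (R : realType) (N : nat) (x : 'rV[R]_N) : R :=
  Num.sqrt (\sum_(i < N) x ord0 i ^+ 2).

(* Neighbourhoods of infinity in R^N: the filter of |x| -> +oo. *)
Definition enorm_pinfty (R : realType) (N : nat) : set_system 'rV[R]_N :=
  filter_from [set: R] (fun r => [set x | r < enorm x]).

Definition exterior_domain (R : realType) (N : nat) (Omega : set 'rV[R]_N) :=
  [/\ open Omega, connected Omega & compact (~` Omega)].

Definition partial (R : realType) (N : nat) (i : 'I_N) (f : 'rV[R]_N -> R) :
    'rV[R]_N -> R :=
  'D_(delta_mx ord0 i) f.

Definition iter_partial (R : realType) (N : nat) (s : seq 'I_N)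
    (f : 'rV[R]_N -> R) : 'rV[R]_N -> R :=
  foldr (@partial R N) f s.

(* C^infinity in Omega: the partial derivatives of all orders (s is the list of
   directions) exist and are continuous at the points of Omega. For Omega open
   this does not depend on the values of f outside Omega. *)
Definition smooth_in (R : realType) (N : nat) (Omega : set 'rV[R]_N)
    (f : 'rV[R]_N -> R) : Prop :=
  forall (s : seq 'I_N) (x : 'rV[R]_N), Omega x ->
    {for x, continuous (iter_partial s f)} /\
    forall i : 'I_N, derivable (iter_partial s f) x (delta_mx ord0 i).

Definition laplacian (R : realType) (N : nat) (f : 'rV[R]_N -> R)
    (x : 'rV[R]_N) : R :=
  \sum_(i < N) partial i (partial i f) x.

(* Main.v *)
(* Suppose that -Delta E >= lam |x|^-2 E near infinity with lam > (N-2)^2/4.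
   For b > 0 small, v(x) = |x|^(-(N-2)/2) sin (2 b (log |x| - c)) satisfies
   -Delta v = ((N-2)^2/4 + 4 b^2) |x|^-2 v with a constant smaller than lam; it
   is positive in an annulus, which may be taken arbitrarily far away, and
   vanishes on its boundary. Hence v / E has an interior maximum t > 0, at which
   t E - v has a zero minimum. There Delta (t E - v) >= 0, whereas the two
   differential relations give Delta (t E - v) < 0. *)
Require Import Defs.
From mathcomp Require Import ring lra.
Import Order.TTheory GRing.Theory Num.Theory.
Local Open Scope classical_set_scope.
Local Open Scope ring_scope.

(** * Second-order conditions at a minimum *)

Lemma is_derive_line (R : realType) (N : nat) (f : 'rV[R]_N -> R)
    (x e : 'rV[R]_N) (h : R) :
  derivable f (x + h *: e) e ->
  is_derive (h : R) 1 (fun k : R => f (x + k *: e)) ('D_e f (x + h *: e)).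
Proof.
have E : (fun k : R => k^-1 *: (((fun k : R => f (x + k *: e)) \o shift h)
     (k *: 1) - f (x + h *: e))) =
   (fun k => k^-1 *: ((f \o shift (x + h *: e)) (k *: e) - f (x + h *: e))).
  apply/funext => k /=; congr (_ *: (f _ - _)).
  by rewrite [k *: 1]mulr1 scalerDl addrCA.
by move=> df; split; rewrite /derivable /derive E.
Qed.

(** By Fermat [g1 0 = 0]; if [l < 0], then [g1] is negative just to the right of 0, and the mean
    value theorem puts [g] below [g 0] there. *)
Lemma second_derivative_ge0_at_min (R : realType) (g g1 : R -> R) (l : R) :
  (\forall h \near (0 : R), is_derive h (1 : R) g (g1 h)) ->
  is_derive (0 : R) 1 g1 l ->
  (\forall h \near (0 : R), g 0 <= g h) ->
  0 <= l.
Proof.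
move=> dg dg1 gmin.
have : \forall h \near (0 : R), is_derive h (1 : R) g (g1 h) /\ g 0 <= g h.
  exact: filterI dg gmin.
move=> /nbhs_ballP[d /= d0 Hd].
have {}dg (h : R) : `|h| < d -> is_derive h (1 : R) g (g1 h).
  by move=> hd; apply: (Hd h _).1; rewrite /ball /= sub0r normrN.
have {}gmin (h : R) : `|h| < d -> g 0 <= g h.
  by move=> hd; apply: (Hd h _).2; rewrite /ball /= sub0r normrN.
have itvd (h : R) : h \in `]- d, d[%R -> `|h| < d.
  by rewrite in_itv /= ltr_norml.
have g10 : g1 0 = 0.
  have Hmin : is_derive (0 : R) 1 g 0.
    apply: (@derive1_at_min _ g (- d) d 0); first lra.
    - by move=> t /itvd /dg [].
    - by rewrite in_itv /=; lra.
    - by move=> t /itvd /gmin.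
  have [_ <-] : is_derive (0 : R) 1 g (g1 0) by apply: dg; rewrite normr0.
  by case: Hmin.
rewrite leNgt; apply/negP => l0.
have [cvg1 vall] := dg1.
have : (fun h => h^-1 *: ((g1 \o shift 0) (h *: 1) - g1 0)) @ (0 : R)^' --> l.
  by rewrite -vall.
move=> /cvgr_lt /(_ _ l0) /nbhs_ballP[e /= e0 He].
pose h := Num.min d e / 2.
have me : 0 < Num.min d e by rewrite lt_min d0.
have hd : h < d.
  by have : Num.min d e <= d; [rewrite ge_min lexx|rewrite /h; lra].
have he : h < e.
  by have : Num.min d e <= e; [rewrite ge_min lexx orbT|rewrite /h; lra].
have h0 : 0 < h by rewrite /h; lra.
have g1neg c : 0 < c -> c < e -> g1 c < 0.
  move=> c0 ce.
  have /= := He c; rewrite /ball /= sub0r normrN gtr0_norm// => /(_ ce).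
  rewrite gt_eqF// => /(_ isT).
  by rewrite addr0 [c *: 1]mulr1 g10 subr0 [_ *: _]mulrC pmulr_llt0 // invr_gt0.
have : exists2 c, c \in `]0, h[%R & g h - g 0 = g1 c * (h - 0).
  apply: MVT => // [x|].
    by rewrite in_itv /= => /andP[x0 xh]; apply: dg; rewrite gtr0_norm//; lra.
  apply: derivable_within_continuous => x; rewrite in_itv /= => /andP[x0 xh].
  have [//] : is_derive (x : R) 1 g (g1 x).
  by apply: dg; rewrite ger0_norm//; lra.
case=> c; rewrite in_itv /= => /andP[c0 ch].
have := gmin h; rewrite gtr0_norm// => /(_ hd) gh E.
have := g1neg c c0 (lt_trans ch he); nra.
Qed.

Lemma near_line {R : realType} {N : nat} {x : 'rV[R]_N} (e : 'rV[R]_N)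
    {P : 'rV[R]_N -> Prop} :
  (\forall y \near x, P y) -> \forall h \near (0 : R), P (x + h *: e).
Proof.
move=> HP; have : (fun h : R => x + h *: e) @ (0 : R) --> x.
  rewrite -[X in _ --> X]addr0 -(scale0r e); apply: cvgD; first exact: cvg_cst.
  exact: cvgZr_tmp.
exact.
Qed.

Definition sqnorm {R : realType} {N : nat} (x : 'rV[R]_N) : R :=
  \sum_(i < N) x ord0 i ^+ 2.

Lemma sqnorm_line (R : realType) (N : nat) (x : 'rV[R]_N) (i : 'I_N) (h : R) :
  sqnorm (x + h *: delta_mx ord0 i) = sqnorm x + 2 * x ord0 i * h + h ^+ 2.
Proof.
rewrite /sqnorm (bigD1 i) //= [in RHS](bigD1 i) //= !mxE !eqxx /=.
rewrite (eq_bigr (fun j => x ord0 j ^+ 2)) => [|j ji]; first by ring.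
by rewrite !mxE (negbTE ji) andbF mulr0 addr0.
Qed.

(* Second derivative test for [f - p \o sqnorm] at a zero minimum [x]; the left
   side is the Laplacian of [p \o sqnorm] at [x]. *)
Lemma laplacian_ge_touching (R : realType) (N : nat) (f : 'rV[R]_N -> R)
    (p p1 : R -> R) (p2 : R) (x : 'rV[R]_N) :
  0 < sqnorm x ->
  (forall s : R, 0 < s -> is_derive s (1 : R) p (p1 s)) ->
  is_derive (sqnorm x) (1 : R) p1 p2 ->
  (forall i, \forall y \near x, derivable f y (delta_mx ord0 i)) ->
  (forall i, derivable (partial i f) x (delta_mx ord0 i)) ->
  (\forall y \near x, p (sqnorm y) <= f y) -> p (sqnorm x) = f x ->
  4 * sqnorm x * p2 + 2 * N%:R * p1 (sqnorm x) <= laplacian f x.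
Proof.
move=> x0 dp dp1 df d2f pf pfx.
suff H i : 4 * x ord0 i ^+ 2 * p2 + 2 * p1 (sqnorm x) <=
    partial i (partial i f) x.
  have -> : 4 * sqnorm x * p2 + 2 * N%:R * p1 (sqnorm x) =
      \sum_(i < N) (4 * x ord0 i ^+ 2 * p2 + 2 * p1 (sqnorm x)).
    rewrite big_split /= -mulr_suml -mulr_sumr sumr_const card_ord.
    by rewrite -[_ *+ N]mulr_natl /sqnorm; ring.
  exact: ler_sum.
pose e : 'rV[R]_N := delta_mx ord0 i; pose c := x ord0 i.
(* [q] is [sqnorm] along the line through [x] in direction [e]. As [q' = 2 * c + 2 * h], the second
   derivative of [p \o q] at 0 is [4 * c ^+ 2 * p2 + 2 * p1 (q 0)]. *)
pose q (h : R) : R := sqnorm x + 2 * c * h + h ^+ 2.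
have dq (h : R) : is_derive h (1 : R) q (2 * c + 2 * h).
  rewrite /q; apply: is_derive_eq; rewrite /GRing.scale /=; ring.
have q0 : q 0 = sqnorm x by rewrite /q; ring.
have qpos : \forall h \near (0 : R), 0 < q h.
  have : {for 0, continuous q}.
    by apply/differentiable_continuous/derivable1_diffP; case: (dq 0).
  by move=> /cvgr_gt; apply; rewrite q0.
rewrite -subr_ge0.
pose g1 (h : R) := partial i f (x + h *: e) - p1 (q h) * (2 * c + 2 * h).
apply: (@second_derivative_ge0_at_min _ (fun h => f (x + h *: e) - p (q h)) g1).
- have dfe := near_line e (df i).
  near=> h; apply: is_deriveB.
    by apply: is_derive_line; near: h.
  apply: (@is_derive1_comp _ p q); last exact: dq.
  by apply: dp; near: h.
- have dl : is_derive (0 : R) (1 : R) (fun h => partial i f (x + h *: e))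
      (partial i (partial i f) x).
    have := @is_derive_line _ _ (partial i f) x e 0.
    by rewrite scale0r addr0; apply.
  have dp1q : is_derive (0 : R) (1 : R) (p1 \o q) (p2 * (2 * c + 2 * 0)).
    by apply: is_derive1_comp; rewrite q0.
  rewrite /g1; apply: is_derive_eq.
  rewrite /= q0 /GRing.scale /= -/c; ring.
- have := near_line e pf; apply: filterS => h.
  rewrite scale0r addr0 q0 pfx subrr subr_ge0.
  by rewrite /e sqnorm_line.
Unshelve. all: by end_near. Qed.

(** * The oscillating radial barrier *)

Section barrier.
Context {R : realType} (a b tau : R).

(** At [s] = |x|^2 one has [ln s] = 2 log |x|, so this is the phase 2 b (log |x| - c) with [tau] = 2
    c. *)
Let u (s : R) := b * (ln s - tau).

(* The variable [s] stands for |x|^2, and [expR (- ln s)] for [s^-1]. *)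
Definition barrier (s : R) : R :=
  expR (- a * ln s) * sin (u s).

Definition barrier1 (s : R) : R :=
  expR (- a * ln s) * (b * cos (u s) - a * sin (u s)) * expR (- ln s).

Definition barrier2 (s : R) : R :=
  expR (- a * ln s) * ((a ^+ 2 - b ^+ 2 + a) * sin (u s)
     - (2 * a + 1) * b * cos (u s)) * expR (- ln s) ^+ 2.

Lemma is_derive_barrier (s : R) :
  0 < s -> is_derive s (1 : R) barrier (barrier1 s).
Proof.
move=> s0; have dln : is_derive s (1 : R) (@ln R) s^-1 by exact: is_derive1_ln.
have sE : expR (- ln s) = s^-1 by rewrite expRN lnK.
apply: is_derive_eq; rewrite /barrier1 sE /u.
by rewrite /GRing.scale /=; ring.
Qed.

Lemma is_derive_barrier1 (s : R) :
  0 < s -> is_derive s (1 : R) barrier1 (barrier2 s).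
Proof.
move=> s0; have dln : is_derive s (1 : R) (@ln R) s^-1 by exact: is_derive1_ln.
have sE : expR (- ln s) = s^-1 by rewrite expRN lnK.
apply: is_derive_eq; rewrite /barrier2 sE /u.
by rewrite /GRing.scale /=; ring.
Qed.

(** When [4 * a + 2] is the dimension, the left side is the Laplacian of [barrier \o sqnorm] where
    |x|^2 = [s]. The cosine terms cancel, which leaves a multiple of the sine. *)
Lemma barrier_ode (s : R) : 0 < s ->
  4 * s * barrier2 s + 2 * (4 * a + 2) * barrier1 s =
  - (4 * a ^+ 2 + 4 * b ^+ 2) * (barrier s / s).
Proof.
move=> s0; rewrite /barrier /barrier1 /barrier2.
have -> : expR (- ln s) = s^-1 by rewrite expRN lnK.
by field; rewrite gt_eqF.
Qed.

End barrier.

(** * Annuli, exterior domains and lower limits *)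

Lemma enorm_sqr (R : realType) (N : nat) (x : 'rV[R]_N) :
  enorm x ^+ 2 = sqnorm x.
Proof. by rewrite sqr_sqrtr // sumr_ge0 // => i _; exact: sqr_ge0. Qed.

Lemma sqnorm_continuous (R : realType) (N : nat) :
  continuous (@sqnorm R N).
Proof.
have -> : @sqnorm R N = \sum_(i < N) (fun x : 'rV[R]_N => x ord0 i ^+ 2).
  by apply/funext => x; rewrite fct_sumE.
elim/big_ind : _ => [x|f g cf cg x|i _ x].
    exact: (@cst_continuous _ _ (0 : R)).
  exact: cvgD (cf x) (cg x).
apply: (@continuous_comp _ _ _ (fun y : 'rV[R]_N => y ord0 i)
  (fun r => r ^+ 2)).
  exact: coord_continuous.
exact: exprn_continuous.
Qed.

Lemma annulus_compact (R : realType) (N : nat) (r1 r2 : R) :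
  compact [set x : 'rV[R]_N | r1 <= sqnorm x <= r2].
Proof.
(* This cube contains the annulus: a number whose square is at most [r2] has absolute value at most
   [1 + r2]. *)
have H : compact [set x : 'rV[R]_N |
    forall i, `[- (1 + r2), 1 + r2]%classic (x ord0 i)].
  apply: (@rV_compact R N (fun=> `[- (1 + r2), 1 + r2]%classic)) => i.
  exact: segment_compact.
apply: subclosed_compact H _.
  rewrite (_ : mkset _ = @sqnorm R N @^-1` `[r1, r2]%classic); last first.
    by apply/seteqP; split => x /=; rewrite in_itv.
  apply: (@preimage_closed _ _ (@sqnorm R N) `[r1, r2]%classic).
    by move=> x _; exact: sqnorm_continuous.
  exact: interval_closed.
move=> x /= /andP[_ xr] i; rewrite in_itv /=.
have : x ord0 i ^+ 2 <= sqnorm x.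
  rewrite /sqnorm (bigD1 i) //= lerDl sumr_ge0 // => j _; exact: sqr_ge0.
by move=> xi; apply/andP; split; nra.
Qed.

Lemma exterior_domain_contains (R : realType) (N : nat) (Omega : set 'rV[R]_N) :
  exterior_domain Omega -> exists M, forall x, M < sqnorm x -> Omega x.
Proof.
(* An empty complement is treated apart, since otherwise [M] is the maximum of [sqnorm] on it. *)
case=> _ _ cO; have [e|/set0P ne] := eqVneq (~` Omega) set0.
  exists 0 => x _; apply: contrapT => xO.
  by have : (~` Omega) x by []; rewrite e.
have [|c _ cmax] := @EVT_max_rV R N sqnorm _ ne cO.
  by apply: continuous_subspaceT; exact: sqnorm_continuous.
exists (sqnorm c) => x cx; apply: contrapT => xO.
by have := cmax x; rewrite inE => /(_ xO); rewrite leNgt cx.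
Qed.

Lemma limf_einf_gt_filter_from (R : realType) (T : topologicalType)
    (I : Type) (D : set I) (B : I -> set T) (f : T -> R) (c : R) :
  (c%:E < limf_einf (fun x => (f x)%:E) (filter_from D B))%E ->
  exists i lam, [/\ D i, c < lam & forall x, B i x -> lam <= f x].
Proof.
rewrite limf_einfE => /ereal_sup_gt[_ [V [i Di BV] <-]] cinf.
have lb x : B i x -> (ereal_inf ((fun x => (f x)%:E) @` V) <= (f x)%:E)%E.
  by move=> Bx; apply: ereal_inf_lbound; exists x => //; exact: BV.
(* An infimum equal to +oo is possible only over an empty set; then any [lam] above [c] serves. *)
case: (ereal_inf _) cinf lb => [lam| |//] clam lb.
  by exists i, lam; split => // x /lb.
by exists i, (c + 1); split; rewrite ?ltrDl // => x /lb.
Qed.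

(** * Comparison of a supersolution with the barrier *)

Lemma no_positive_supersolution (R : realType) (N : nat) (hN : (0 < N)%N)
    (E : 'rV[R]_N -> R) (lam M : R) :
  (N%:R - 2) ^+ 2 / 4 < lam ->
  (forall x, M < sqnorm x -> {for x, continuous E}) ->
  (forall x, M < sqnorm x -> forall i, derivable E x (delta_mx ord0 i)) ->
  (forall x, M < sqnorm x -> forall i,
    derivable (partial i E) x (delta_mx ord0 i)) ->
  (forall x, M < sqnorm x -> 0 < E x) ->
  (forall x, M < sqnorm x -> lam * E x <= sqnorm x * - laplacian E x) -> False.
Proof.
move=> hlam Ec dE d2E E0 HE.
(* This gives [4 * a + 2 = N%:R] and [4 * a ^+ 2] = (N-2)^2/4; [b] is chosen so that [4 * b ^+ 2] is
   half the gap between [lam] and that constant. *)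
pose a : R := (N%:R - 2) / 4.
pose b : R := Num.sqrt ((lam - (N%:R - 2) ^+ 2 / 4) / 8).
have b0 : 0 < b by rewrite sqrtr_gt0; lra.
have bE : 4 * a ^+ 2 + 4 * b ^+ 2 < lam.
  rewrite sqr_sqrtr; last lra.
  by rewrite /a; lra.
(* The phase is 0 at [s1] and pi at [s2], so these are consecutive zeros of the barrier. *)
pose s1 : R := Num.max M 0 + 1; pose tau := ln s1.
have Ms1 : M < s1.
  by have : M <= Num.max M 0; [rewrite le_max lexx|rewrite /s1; lra].
have s10 : 0 < s1.
  by have : 0 <= Num.max M 0; [rewrite le_max lexx orbT|rewrite /s1; lra].
pose s2 := expR (tau + pi / b).
pose v := @barrier R a b tau.
have vs1 : v s1 = 0 by rewrite /v /barrier subrr mulr0 sin0 mulr0.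
have vs2 : v s2 = 0.
  rewrite /v /barrier /s2 expRK (_ : b * _ = pi); first by rewrite sinpi mulr0.
  by field; rewrite gt_eqF.
have vpos s : s1 < s -> s < s2 -> 0 < v s.
  move=> ls hs; have s0 := lt_trans s10 ls.
  rewrite /v /barrier mulr_gt0 ?expR_gt0 // sin_gt0_pi //; apply/andP; split.
    by rewrite mulr_gt0 // subr_gt0 /tau ltr_ln.
  rewrite mulrC -ltr_pdivlMr // ltrBlDl -ltr_expR lnK //.
have pi0 := @pi_gt0 R.
pose K := [set x : 'rV[R]_N | s1 <= sqnorm x <= s2].
have KM x : K x -> M < sqnorm x by move=> /andP[+ _]; exact: lt_le_trans.
pose i0 : 'I_N := Ordinal hN.
(* The phase is pi/2 at [sm]; the point [xm] of the open annulus makes the maximum of the quotient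
   positive. *)
pose sm := expR (tau + pi / b / 2).
have pb0 : 0 < pi / b by rewrite divr_gt0.
have s1m : s1 < sm by rewrite -[s1]lnK // /sm ltr_expR -/tau; lra.
have sm2 : sm < s2 by rewrite /sm /s2 ltr_expR; lra.
pose xm : 'rV[R]_N := Num.sqrt sm *: delta_mx ord0 i0.
have xmE : sqnorm xm = sm.
  rewrite /xm -[_ *: _]add0r sqnorm_line sqr_sqrtr; last by rewrite expR_ge0.
  rewrite mxE /sqnorm big1 => [|i _]; last by rewrite mxE expr0n.
  by rewrite mulr0 mul0r !add0r.
have Kxm : K xm by rewrite /K /= xmE !ltW.
have [||x xK xmax] := @EVT_max_rV R N (fun x => v (sqnorm x) / E x) K _
    (@annulus_compact R N s1 s2).
- by exists xm.
- apply: continuous_in_subspaceT => x; rewrite inE => Kx.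
  have Mx := KM _ Kx; have x0 : 0 < sqnorm x.
    by case/andP: Kx => + _; exact: lt_le_trans.
  have cv : v (sqnorm y) @[y --> x] --> v (sqnorm x).
    apply: (@continuous_comp _ _ _ (@sqnorm R N) v).
      exact: sqnorm_continuous.
    apply/differentiable_continuous/derivable1_diffP.
    by have [] := @is_derive_barrier R a b tau _ x0.
  have cE : (E y)^-1 @[y --> x] --> (E x)^-1.
    by apply: cvgV (Ec _ Mx); rewrite gt_eqF // E0.
  exact: cvgM cv cE.
move: xK; rewrite inE => Kx.
pose t := v (sqnorm x) / E x.
have Ex := E0 _ (KM _ Kx).
have t0 : 0 < t.
  apply: lt_le_trans (xmax xm _); last by rewrite inE.
  by rewrite xmE divr_gt0 ?vpos ?E0 ?xmE ?(lt_trans Ms1).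
have vx : v (sqnorm x) = t * E x by rewrite /t divfK // gt_eqF.
have vx0 : 0 < v (sqnorm x) by rewrite vx mulr_gt0.
have lx : s1 < sqnorm x.
  rewrite lt_neqAle; case/andP: (Kx) => -> _; rewrite andbT.
  by apply/eqP => e; move: vx0; rewrite -e vs1 ltxx.
have hx : sqnorm x < s2.
  rewrite lt_neqAle; case/andP: (Kx) => _ ->; rewrite andbT.
  by apply/eqP => e; move: vx0; rewrite e vs2 ltxx.
have x0 : 0 < sqnorm x := lt_trans s10 lx.
have nearK : \forall y \near x, s1 < sqnorm y /\ sqnorm y < s2.
  have c := @sqnorm_continuous R N x.
  apply: filterI; first by move/cvgr_gt: c; apply.
  by move/cvgr_lt: c; apply.
(* After division by [t], the function [p \o sqnorm] touches [E] from below at [x]. *)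
pose p s := t^-1 * v s; pose p1 s := t^-1 * barrier1 a b tau s.
have dp (s : R) : 0 < s -> is_derive s (1 : R) p (p1 s).
  by move=> s0; have d := @is_derive_barrier R a b tau s s0; exact: is_deriveZ.
have dp1 : is_derive (sqnorm x) (1 : R) p1 (t^-1 * barrier2 a b tau (sqnorm x)).
  by have d := @is_derive_barrier1 R a b tau _ x0; exact: is_deriveZ.
have dEx i : \forall y \near x, derivable E y (delta_mx ord0 i).
  by apply: filterS nearK => y [ly _]; exact/dE/(lt_trans Ms1).
have pE : \forall y \near x, p (sqnorm y) <= E y.
  apply: filterS nearK => y [ly hy].
  have Ey : 0 < E y by apply/E0/(lt_trans Ms1).
  rewrite /p ler_pdivrMl // -ler_pdivrMr //; apply: xmax.
  by rewrite inE /K /= !ltW.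
have pEx : p (sqnorm x) = E x by rewrite /p vx mulrA mulVf ?mul1r // gt_eqF.
have H := @laplacian_ge_touching R N E p p1 _ x x0 dp dp1 dEx
  (d2E x (KM _ Kx)) pE pEx.
have ode := @barrier_ode R a b tau _ x0.
have L : - (4 * a ^+ 2 + 4 * b ^+ 2) * E x <= sqnorm x * laplacian E x.
  rewrite mulrC -ler_pdivrMl //; apply: le_trans H.
  rewrite le_eqVlt; apply/orP; left; apply/eqP.
  transitivity (t^-1 * (4 * sqnorm x * barrier2 a b tau (sqnorm x) +
    2 * (4 * a + 2) * barrier1 a b tau (sqnorm x))).
    rewrite ode -/v vx; field; rewrite !gt_eqF //.
  have -> : 4 * a + 2 = N%:R by rewrite /a; field.
  by rewrite /p1; ring.
(* Together with [L] this would give [lam * E x <= (4 * a ^+ 2 + 4 * b ^+ 2) * E x], against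
   [bE]. *)
have := HE x (KM _ Kx).
have : 0 < (lam - (4 * a ^+ 2 + 4 * b ^+ 2)) * E x.
  by rewrite mulr_gt0 // subr_gt0.
lra.
Qed.

(* E is a total function of which only the values in Omega matter: since
   Omega has compact complement, it contains some {|x| > R0}, hence the lower
   limit at infinity does not see the values of E outside Omega. *)
Theorem corollary1 (R : realType) (N : nat) (hN : (3 <= N)%N)
    (Omega : set 'rV[R]_N) (hOmega : exterior_domain Omega)
    (E : 'rV[R]_N -> R) (E_smooth : smooth_in Omega E)
    (E_pos : forall x, Omega x -> 0 < E x)
    (E_superharmonic : forall x, Omega x -> 0 <= - laplacian E x) :
  (limf_einf
     (fun x : 'rV[R]_N => (enorm x ^+ 2 * (- laplacian E x / E x))%:E)
     (@enorm_pinfty R N)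
   <= ((N%:R - 2) ^+ 2 / 4)%:E)%E.
Proof.
rewrite leNgt; apply/negP => /limf_einf_gt_filter_from[r [lam [_ hlam HE]]].
have [M MO] := exterior_domain_contains _ _ _ hOmega.
pose M' := Num.max M (r ^+ 2).
have M'O x : M' < sqnorm x -> Omega x by rewrite gt_max => /andP[/MO].
apply: (no_positive_supersolution _ _ (ltnW (ltnW hN)) E lam M') hlam _ _ _ _ _;
  move=> x /[dup] /M'O Ox.
- by move=> _; have [] := E_smooth [::] x Ox.
- by move=> _ i; have [_] := E_smooth [::] x Ox; apply.
- by move=> _ i; have [_] := E_smooth [:: i] x Ox; apply.
- by move=> _; exact: E_pos.
rewrite gt_max => /andP[_ rx].
have rE : r < enorm x.
  (* The sign of [r] is unknown, but [enorm x <= r] forces [0 <= r], so this inequality may be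
     squared. *)
  rewrite ltNge; apply/negP => xr.
  move: rx; rewrite -enorm_sqr ltNge => /negP; apply.
  by rewrite lerXn2r // nnegrE ?sqrtr_ge0 // (le_trans _ xr) ?sqrtr_ge0.
have := HE x rE; rewrite enorm_sqr mulrA ler_pdivlMr //; exact: E_pos.
Qed.
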